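(* Let $\mathbb A$ be a distributive monoidal category and let $\mathbf H\,\ulcorner\mathbb A\urcorner^{\oplus}$ be the category of horizontal cells of its free cornering with choice. Then: (i) $\mathbf H\,\ulcorner\mathbb A\urcorner^{\oplus}$ has binary products $U\xleftarrow{\pi_0}U\times W\xrightarrow{\pi_1}W$; (ii) $\mathbf H\,\ulcorner\mathbb A\urcorner^{\oplus}$ has binary coproducts $U\xrightarrow{\iota_0}U+W\xleftarrow{\iota_1}W$.
   Context: Monoidal categories are strict, and composites are in diagrammatic order ($fg$ is first $f$, then $g$). A single-object double category $\mathbb D$ has a horizontal edge monoid $(\mathbb D_H,\otimes,I)$, a vertical edge monoid $(\mathbb D_V,\otimes,I)$, and for $A,B\in\mathbb D_H$, $U,W\in\mathbb D_V$ a set of cells $(U;A;B;W)$ (left; top; bottom; right boundary). For $\alpha:(U;A;B;V)$ and $\beta:(V;A';B';W)$ there is a horizontal composite $\alpha\mid\beta:(U;A\otimes A';B\otimes B';W)$; for $\alpha:(U;A;C;W)$ and $\beta:(U';C;B;W')$ a vertical composite $\frac{\alpha}{\beta}:(U\otimes U';A;B;W\otimes W')$. Both are associative and unital, with horizontal units $id_U:(U;I;I;U)$ and vertical units $1_A:(I;A;A;I)$, where $id_I=1_I$, $1_{A\otimes B}=1_A\mid 1_B$, $id_{U\otimes W}=\frac{id_U}{id_W}$, and interchange $\frac{\alpha}{\beta}\mid\frac{\gamma}{\delta}=\frac{\alpha\mid\gamma}{\beta\mid\delta}$ holds. $\mathbf H\,\mathbb D$ is the monoidal category with objects the elements of $\mathbb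 D_V$, morphisms $U\to W$ the cells $(U;I;I;W)$, composition $\mid$, and tensor given by vertical composition. A distributive monoidal category $(\mathbb A,\otimes,\oplus,I)$ is a symmetric monoidal category with binary coproducts $A\oplus B$ (injections $\sigma_0,\sigma_1$, copairing $[f,g]$; no initial object required) such that $[\sigma_0\otimes 1_C,\sigma_1\otimes 1_C]:(A\otimes C)\oplus(B\otimes C)\to(A\oplus B)\otimes C$ is invertible for all $A,B,C$. Exchanges with choice: $\mathbb A^{\circ\bullet}_\oplus$ is the monoid (operation $\otimes$, unit $I$) with elements generated by $A^\circ$, $A^\bullet$ ($A\in\mathbb A_0$), $I$, $U\otimes W$, $U\times W$, $U+W$, subject only to associativity and unitality of $\otimes$. Free cornering with choice: $\ulcorner\mathbb A\urcorner^{\oplus}$ is the free single-object double category with horizontal edge monoid $(\mathbb A_0,\otimes,I)$, vertical edge monoid $\mathbb A^{\circ\bullet}_\oplus$, and generating cells and equations: (1) for each $f:A\to B$ in $\mathbb A$ a cell $\ulcorner f\urcorner:(I;A;B;I)$ (also written $f$), with $\ulcorner fg\urcorner=\frac{\ulcorner f\urcorner}{\ulcorner g\urcorner}$, $\ulcorner 1_A\urcorner=1_A$, $\ulcorner f\otimes g\urcorner=\ulcorner f\urcorner\mid\ulcorner g\urcorner$; (2) for each $A\in\mathbb A_0$ corner cells $\mathsf{get}_L^A:(A^\circ;I;A;I)$, $\mathsf{put}_R^A:(I;A;I;A^\circ)$, $\mathsf{get}_R^A:(I;I;A;A^\bullet)$, $\mathsf{put}_L^A:(A^\bullet;A;I;I)$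 with $\mathsf{put}_R^A\mid\mathsf{get}_L^A=1_A$, $\frac{\mathsf{get}_L^A}{\mathsf{put}_R^A}=id_{A^\circ}$, $\mathsf{get}_R^A\mid\mathsf{put}_L^A=1_A$, $\frac{\mathsf{get}_R^A}{\mathsf{put}_L^A}=id_{A^\bullet}$; (3) for all $U,W$, cells $\pi_0:(U\times W;I;I;U)$, $\pi_1:(U\times W;I;I;W)$, and for $\alpha:(V;A;B;U)$, $\beta:(V;A;B;W)$ a unique cell $\alpha\times\beta:(V;A;B;U\times W)$ with $(\alpha\times\beta)\mid\pi_0=\alpha$, $(\alpha\times\beta)\mid\pi_1=\beta$; (4) for all $U,W$, cells $\iota_0:(U;I;I;U+W)$, $\iota_1:(W;I;I;U+W)$, and for $\alpha:(U;A;B;V)$, $\beta:(W;A;B;V)$ a unique cell $\alpha+\beta:(U+W;A;B;V)$ with $\iota_0\mid(\alpha+\beta)=\alpha$, $\iota_1\mid(\alpha+\beta)=\beta$; (5) for $\alpha:(U;A;C;W)$, $\beta:(U;B;C;W)$ a unique cell $[\alpha,\beta]:(U;A\oplus B;C;W)$ with $\frac{\ulcorner\sigma_0\urcorner}{[\alpha,\beta]}=\alpha$, $\frac{\ulcorner\sigma_1\urcorner}{[\alpha,\beta]}=\beta$. *)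

(* Defs.v *)
From HB Require Import structures.
From mathcomp Require Import all_boot.
From mathcomp Require Import boolp.

Set Implicit Arguments.
Unset Strict Implicit.
Unset Printing Implicit Defensive.

Local Open Scope quotient_scope.

(* Composition is written in diagrammatic order. *)
Record category := Category {
  obj :> Type;
  hom : obj -> obj -> Type;
  idm : forall A, hom A A;
  comp : forall A B C, hom A B -> hom B C -> hom A C;
  compA : forall A B C D (f : hom A B) (g : hom B C) (h : hom C D),
    comp f (comp g h) = comp (comp f g) h;
  comp1f : forall A B (f : hom A B), comp (idm A) f = f;
  compf1 : forall A B (f : hom A B), comp f (idm B) = f }.

Arguments hom {c} A B.
Arguments idm {c} A.
Notation "f ;; g" := (comp f g) (at level 60, right associativity).

(* The identity, seen as a morphism between propositionally equal objects. *)
Definition eqhom (C : category) (A B : C) (e : A = B) : hom A B :=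
  match e in _ = X return hom A X with erefl => idm A end.

Definition is_iso (C : category) (A B : C) (f : hom A B) : Prop :=
  exists g : hom B A, f ;; g = idm A /\ g ;; f = idm B.

Definition is_product (C : category) (X Y P : C)
    (p0 : hom P X) (p1 : hom P Y) : Prop :=
  forall (Z : C) (f : hom Z X) (g : hom Z Y),
    exists! h : hom Z P, h ;; p0 = f /\ h ;; p1 = g.

Arguments is_product {C} X Y P p0 p1.

Definition is_coproduct (C : category) (X Y Q : C)
    (i0 : hom X Q) (i1 : hom Y Q) : Prop :=
  forall (Z : C) (f : hom X Z) (g : hom Y Z),
    exists! h : hom Q Z, i0 ;; h = f /\ i1 ;; h = g.

Arguments is_coproduct {C} X Y Q i0 i1.

(* Not mathcomp's monoidType, which bundles a choiceType: the elements will be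
   the objects of an arbitrary category. *)
Record monoid := Monoid {
  mcar :> Type;
  mop : mcar -> mcar -> mcar;
  munit : mcar;
  mopA : forall x y z, mop x (mop y z) = mop (mop x y) z;
  mop1x : forall x, mop munit x = x;
  mopx1 : forall x, mop x munit = x }.

Arguments mop {m} x y.
Arguments munit {m}.

(* The tensor is associative and unital on the nose on objects; on morphisms
   this says that the identities [eqhom _] are natural. *)
Record strict_monoidal := StrictMonoidal {
  scat :> category;
  tens : scat -> scat -> scat;
  tunit : scat;
  tensA : forall A B C, tens A (tens B C) = tens (tens A B) C;
  tens1x : forall A, tens tunit A = A;
  tensx1 : forall A, tens A tunit = A;
  tensm : forall (A B A' B' : scat),
    hom A B -> hom A' B' -> hom (tens A A') (tens B B');
  tensm_id : forall A B, tensm (idm A) (idm B) = idm (tens A B);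
  tensm_comp : forall (A B C A' B' C' : scat) (f : hom A B) (g : hom B C)
      (f' : hom A' B') (g' : hom B' C'),
    tensm (f ;; g) (f' ;; g') = tensm f f' ;; tensm g g';
  tensmA : forall (A B A' B' A'' B'' : scat)
      (f : hom A B) (f' : hom A' B') (f'' : hom A'' B''),
    tensm f (tensm f' f'') ;; eqhom (tensA B B' B'') =
    eqhom (tensA A A' A'') ;; tensm (tensm f f') f'';
  tensm1x : forall (A B : scat) (f : hom A B),
    tensm (idm tunit) f ;; eqhom (tens1x B) = eqhom (tens1x A) ;; f;
  tensmx1 : forall (A B : scat) (f : hom A B),
    tensm f (idm tunit) ;; eqhom (tensx1 B) = eqhom (tensx1 A) ;; f }.

Arguments tens {s} A B.
Arguments tunit {s}.
Arguments tensm {s A B A' B'} f g.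
Notation "A ⊗ B" := (tens A B) (at level 40, left associativity).
Notation "f ⊗m g" := (tensm f g) (at level 40, left associativity).

Definition obj_monoid (C : strict_monoidal) : monoid :=
  Monoid (@tensA C) (@tens1x C) (@tensx1 C).

Record symmetric_monoidal := SymmetricMonoidal {
  smcat :> strict_monoidal;
  braid : forall A B : smcat, hom (A ⊗ B) (B ⊗ A);
  braid_nat : forall (A B A' B' : smcat) (f : hom A B) (g : hom A' B'),
    f ⊗m g ;; braid B B' = braid A A' ;; g ⊗m f;
  braidK : forall A B, braid A B ;; braid B A = idm (A ⊗ B);
  braid_hexagon : forall A B C : smcat,
    braid A (B ⊗ C) =
    eqhom (tensA A B C) ;; braid A B ⊗m idm C ;; eqhom (esym (tensA B A C))
      ;; idm B ⊗m braid A C ;; eqhom (tensA B C A) }.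

Record distributive_monoidal := DistributiveMonoidal {
  dmcat :> symmetric_monoidal;
  oplus : dmcat -> dmcat -> dmcat;
  inj0 : forall A B, hom A (oplus A B);
  inj1 : forall A B, hom B (oplus A B);
  copair : forall A B C : dmcat, hom A C -> hom B C -> hom (oplus A B) C;
  copair_inj0 : forall (A B C : dmcat) (f : hom A C) (g : hom B C),
    inj0 A B ;; copair f g = f;
  copair_inj1 : forall (A B C : dmcat) (f : hom A C) (g : hom B C),
    inj1 A B ;; copair f g = g;
  copair_uniq : forall (A B C : dmcat) (f : hom A C) (g : hom B C)
      (h : hom (oplus A B) C),
    inj0 A B ;; h = f -> inj1 A B ;; h = g -> h = copair f g;
  distr_iso : forall A B C : dmcat,
    is_iso (copair (inj0 A B ⊗m idm C) (inj1 A B ⊗m idm C)) }.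

Arguments oplus {d} A B.
Arguments inj0 {d} A B.
Arguments inj1 {d} A B.
Notation "A ⊕ B" := (oplus A B) (at level 50, left associativity).

(* Equality of two cells up to transport along equalities of boundaries; the
   laws relate cells whose boundaries are only propositionally equal. *)
Inductive cell_eq (H V : Type) (cell : V -> H -> H -> V -> Type)
    (U : V) (A B : H) (W : V) (x : cell U A B W) :
    forall (U' : V) (A' B' : H) (W' : V), cell U' A' B' W' -> Prop :=
  CellEq : cell_eq x x.

Notation "x ≡ y" := (cell_eq x y) (at level 70, no associativity).

(* [cell U A B W] is the set of cells with left, top, bottom and right
   boundaries U, A, B, W. *)
Record double_category := DoubleCategory {
  hor : monoid;
  ver : monoid;
  cell : ver -> hor -> hor -> ver -> Type;
  hid : forall U : ver, cell U munit munit U;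
  vid : forall A : hor, cell munit A A munit;
  hcomp : forall U V W A B A' B',
    cell U A B V -> cell V A' B' W -> cell U (mop A A') (mop B B') W;
  vcomp : forall U W U' W' A B C,
    cell U A C W -> cell U' C B W' -> cell (mop U U') A B (mop W W');
  hcompA : forall U V W X A B A' B' A'' B''
      (x : cell U A B V) (y : cell V A' B' W) (z : cell W A'' B'' X),
    hcomp x (hcomp y z) ≡ hcomp (hcomp x y) z;
  hcomp1x : forall U W A B (x : cell U A B W), hcomp (hid U) x ≡ x;
  hcompx1 : forall U W A B (x : cell U A B W), hcomp x (hid W) ≡ x;
  vcompA : forall U W U' W' U'' W'' A B C D
      (x : cell U A B W) (y : cell U' B C W') (z : cell U'' C D W''),
    vcomp x (vcomp y z) ≡ vcomp (vcomp x y) z;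
  vcomp1x : forall U W A B (x : cell U A B W), vcomp (vid A) x ≡ x;
  vcompx1 : forall U W A B (x : cell U A B W), vcomp x (vid B) ≡ x;
  hid_unit : hid munit ≡ vid munit;
  vid_op : forall A B, vid (mop A B) ≡ hcomp (vid A) (vid B);
  hid_op : forall U W, hid (mop U W) ≡ vcomp (hid U) (hid W);
  interchange : forall U V W U' V' W' A B C A' B' C'
      (x : cell U A C V) (y : cell U' C B V')
      (z : cell V A' C' W) (t : cell V' C' B' W'),
    hcomp (vcomp x y) (vcomp z t) = vcomp (hcomp x z) (hcomp y t) }.

Arguments cell {d} U A B W.
Arguments hid {d} U.
Arguments vid {d} A.

Section CellEqTheory.
Variables (H V : Type) (cell : V -> H -> H -> V -> Type).

Let total := {b : V * H * H * V & cell b.1.1.1 b.1.1.2 b.1.2 b.2}.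

Lemma cell_eqE U A B W (x y : cell U A B W) : x ≡ y -> x = y.
Proof.
move=> e.
have {e} : existT _ (U, A, B, W) x = existT _ (U, A, B, W) y :> total.
  by refine (match e in @cell_eq _ _ _ _ _ _ _ _ U' A' B' W' z
    return existT _ (U, A, B, W) x = existT _ (U', A', B', W') z :> total
    with CellEq => erefl end).
move=> e; have := projT2_eq e.
by rewrite (Prop_irrelevance (projT1_eq e) erefl).
Qed.

Lemma cell_eq_sym U A B W U' A' B' W'
    (x : cell U A B W) (y : cell U' A' B' W') : x ≡ y -> y ≡ x.
Proof. by case. Qed.

Lemma cell_eq_trans U A B W U' A' B' W' U'' A'' B'' W'' (x : cell U A B W)
    (y : cell U' A' B' W') (z : cell U'' A'' B'' W'') :
  x ≡ y -> y ≡ z -> x ≡ z.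
Proof. by move=> + e; case: _ _ _ _ _ / e. Qed.

Definition cell_cast U A B A' B' W (eA : A = A') (eB : B = B')
    (x : cell U A B W) : cell U A' B' W :=
  match eA in _ = A', eB in _ = B' return cell U A' B' W with
  | erefl, erefl => x
  end.

Lemma cell_castE U A B A' B' W (eA : A = A') (eB : B = B')
  (x : cell U A B W) : x ≡ cell_cast eA eB x.
Proof. by case: _ / eA; case: _ / eB. Qed.

End CellEqTheory.

Section HorizontalCells.
Variable D : double_category.

Definition hc_hom (U W : ver D) : Type := cell U (@munit (hor D)) munit W.

(* The horizontal composite has boundary I ⊗ I at the top and bottom. *)
Definition hc_comp (U V W : ver D) (x : hc_hom U V) (y : hc_hom V W) :
    hc_hom U W :=
  cell_cast (mop1x munit) (mop1x munit) (hcomp x y).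

Lemma hc_compE (U V W : ver D) (x : hc_hom U V) (y : hc_hom V W) :
  hc_comp x y ≡ hcomp x y.
Proof. exact/cell_eq_sym/cell_castE. Qed.

Lemma hcomp_cast U V W A B A' B' A2 B2 A2' B2' (eA : A = A2) (eB : B = B2)
    (eA' : A' = A2') (eB' : B' = B2')
    (x : @cell D U A B V) (y : cell V A' B' W) :
  hcomp x y ≡ hcomp (cell_cast eA eB x) (cell_cast eA' eB' y).
Proof.
by case: _ / eA; case: _ / eB; case: _ / eA'; case: _ / eB'.
Qed.

Lemma hc_compA (U V W X : ver D)
    (x : hc_hom U V) (y : hc_hom V W) (z : hc_hom W X) :
  hc_comp x (hc_comp y z) = hc_comp (hc_comp x y) z.
Proof.
apply: cell_eqE; apply: cell_eq_trans (hc_compE _ _) _.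
apply: cell_eq_sym; apply: cell_eq_trans (hc_compE _ _) _.
apply: cell_eq_trans (cell_eq_sym (hcomp_cast _ _ erefl erefl _ _)) _.
apply: cell_eq_trans (cell_eq_sym (hcompA _ _ _)) _.
exact: (hcomp_cast erefl erefl).
Qed.

Lemma hc_comp1x (U W : ver D) (x : hc_hom U W) : hc_comp (hid U) x = x.
Proof.
apply: cell_eqE; apply: cell_eq_trans (hc_compE _ _) _; exact: hcomp1x.
Qed.

Lemma hc_compx1 (U W : ver D) (x : hc_hom U W) : hc_comp x (hid W) = x.
Proof.
apply: cell_eqE; apply: cell_eq_trans (hc_compE _ _) _; exact: hcompx1.
Qed.

Definition horizontal_category : category :=
  Category hc_compA hc_comp1x hc_compx1.

Definition hc_tensm (U W U' W' : horizontal_category)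
    (x : hom U W) (y : hom U' W') : @hom horizontal_category (mop U U') (mop W W')
  := vcomp x y.

Lemma hc_tensm_id (U W : horizontal_category) :
  hc_tensm (idm U) (idm W) = idm (mop U W : horizontal_category).
Proof. by apply: cell_eqE; apply: cell_eq_sym; exact: hid_op. Qed.

Lemma vcomp_cast U W U' W' A B C A2 B2 C2 (eA : A = A2) (eB : B = B2)
    (eC eC' : C = C2) (x : @cell D U A C W) (y : cell U' C B W') :
  vcomp x y ≡ vcomp (cell_cast eA eC x) (cell_cast eC' eB y).
Proof.
rewrite (Prop_irrelevance eC' eC).
by case: _ / eA; case: _ / eB; case: _ / eC {eC'} y.
Qed.

Lemma hc_tensm_comp (U V W U' V' W' : horizontal_category)
    (x : hom U V) (z : hom V W) (y : hom U' V') (t : hom V' W') :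
  hc_tensm (x ;; z) (y ;; t) = hc_tensm x y ;; hc_tensm z t.
Proof.
apply: cell_eqE; apply: cell_eq_sym; apply: cell_eq_trans (hc_compE _ _) _.
rewrite interchange; exact: vcomp_cast.
Qed.

Lemma hc_eqhom (U W U' W' : horizontal_category) (eU : U = U') (eW : W = W')
    (x : hom U W) (y : hom U' W') :
  cell_eq (cell := @cell D) x y -> x ;; eqhom eW = eqhom eU ;; y.
Proof.
destruct eU, eW => xy; rewrite (cell_eqE (cell := @cell D) xy) /=.
by rewrite hc_compx1 hc_comp1x.
Qed.

Lemma hc_tensmA (U W U' W' U'' W'' : horizontal_category)
    (x : hom U W) (y : hom U' W') (z : hom U'' W'') :
  hc_tensm x (hc_tensm y z)
    ;; @eqhom horizontal_category _ _ (mopA W W' W'') =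
  @eqhom horizontal_category _ _ (mopA U U' U'')
    ;; hc_tensm (hc_tensm x y) z.
Proof. by apply: hc_eqhom; exact: vcompA. Qed.

Lemma hid_unitE : hid munit = vid munit :> @cell D munit munit munit munit.
Proof. exact: cell_eqE (hid_unit D). Qed.

Lemma hc_tensm1x (U W : horizontal_category) (x : hom U W) :
  hc_tensm (idm (munit : horizontal_category)) x
    ;; @eqhom horizontal_category _ _ (mop1x W) =
  @eqhom horizontal_category _ _ (mop1x U) ;; x.
Proof.
apply: hc_eqhom; rewrite /hc_tensm /= hid_unitE; exact: vcomp1x.
Qed.

Lemma hc_tensmx1 (U W : horizontal_category) (x : hom U W) :
  hc_tensm x (idm (munit : horizontal_category))
    ;; @eqhom horizontal_category _ _ (mopx1 W) =
  @eqhom horizontal_category _ _ (mopx1 U) ;; x.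
Proof.
apply: hc_eqhom; rewrite /hc_tensm /= hid_unitE; exact: vcompx1.
Qed.

Definition horizontal_cells : strict_monoidal :=
  StrictMonoidal hc_tensm_id hc_tensm_comp hc_tensmA hc_tensm1x hc_tensmx1.

End HorizontalCells.

Section Exchanges.
Variable O : Type.

Inductive exch_term : Type :=
| xCirc of O
| xBul of O
| xUnit
| xTens of exch_term & exch_term
| xProd of exch_term & exch_term
| xSum of exch_term & exch_term.

Inductive exch_eqv : exch_term -> exch_term -> Prop :=
| xe_refl u : exch_eqv u u
| xe_sym u v : exch_eqv u v -> exch_eqv v u
| xe_trans u v w : exch_eqv u v -> exch_eqv v w -> exch_eqv u w
| xe_tens u u' v v' : exch_eqv u u' -> exch_eqv v v' ->
    exch_eqv (xTens u v) (xTens u' v')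
| xe_prod u u' v v' : exch_eqv u u' -> exch_eqv v v' ->
    exch_eqv (xProd u v) (xProd u' v')
| xe_sum u u' v v' : exch_eqv u u' -> exch_eqv v v' ->
    exch_eqv (xSum u v) (xSum u' v')
| xe_assoc u v w : exch_eqv (xTens u (xTens v w)) (xTens (xTens u v) w)
| xe_unitl u : exch_eqv (xTens xUnit u) u
| xe_unitr u : exch_eqv (xTens u xUnit) u.

HB.instance Definition _ := gen_eqMixin exch_term.
HB.instance Definition _ := gen_choiceMixin exch_term.

Definition exch_rel : rel exch_term := fun u v => `[< exch_eqv u v >].

Lemma exch_rel_refl : reflexive exch_rel.
Proof. by move=> u; apply/asboolP; exact: xe_refl. Qed.

Lemma exch_rel_sym : symmetric exch_rel.
Proof. by move=> u v; apply/asboolP/asboolP; exact: xe_sym. Qed.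

Lemma exch_rel_trans : transitive exch_rel.
Proof.
move=> v u w /asboolP uv /asboolP vw; apply/asboolP; exact: xe_trans uv vw.
Qed.

Canonical exch_equiv := EquivRel exch_rel exch_rel_refl exch_rel_sym exch_rel_trans.

Definition exch : Type := {eq_quot exch_rel}.

Definition exch_class (u : exch_term) : exch := \pi_{eq_quot exch_rel} u.
Definition exch_repr (u : exch) : exch_term := @repr _ {eq_quot exch_rel} u.

Lemma exch_reprK u : exch_class (exch_repr u) = u.
Proof. exact: reprK. Qed.

Lemma exch_classP u v : exch_class u = exch_class v <-> exch_eqv u v.
Proof.
split; first by move/eqmodP/asboolP.
by move=> uv; apply/eqmodP/asboolP.
Qed.

Lemma exch_reprP u : exch_eqv (exch_repr (exch_class u)) u.
Proof. by apply/exch_classP; rewrite exch_reprK. Qed.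

Definition eCirc (A : O) : exch := exch_class (xCirc A).
Definition eBul (A : O) : exch := exch_class (xBul A).
Definition eUnit : exch := exch_class xUnit.
Definition eTens (u v : exch) : exch :=
  exch_class (xTens (exch_repr u) (exch_repr v)).
Definition eProd (u v : exch) : exch :=
  exch_class (xProd (exch_repr u) (exch_repr v)).
Definition eSum (u v : exch) : exch :=
  exch_class (xSum (exch_repr u) (exch_repr v)).

Lemma eTensE u v : eTens (exch_class u) (exch_class v) = exch_class (xTens u v).
Proof. by apply/exch_classP; apply: xe_tens; exact: exch_reprP. Qed.

Lemma eProdE u v : eProd (exch_class u) (exch_class v) = exch_class (xProd u v).
Proof. by apply/exch_classP; apply: xe_prod; exact: exch_reprP. Qed.

Lemma eSumE u v : eSum (exch_class u) (exch_class v) = exch_class (xSum u v).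
Proof. by apply/exch_classP; apply: xe_sum; exact: exch_reprP. Qed.

Lemma eTensA u v w : eTens u (eTens v w) = eTens (eTens u v) w.
Proof.
rewrite -[u]exch_reprK -[v]exch_reprK -[w]exch_reprK !eTensE.
apply/exch_classP; exact: xe_assoc.
Qed.

Lemma eTens1x u : eTens eUnit u = u.
Proof.
by rewrite -[u]exch_reprK eTensE; apply/exch_classP; exact: xe_unitl.
Qed.

Lemma eTensx1 u : eTens u eUnit = u.
Proof.
by rewrite -[u]exch_reprK eTensE; apply/exch_classP; exact: xe_unitr.
Qed.

Definition exchanges : monoid := Monoid eTensA eTens1x eTensx1.

End Exchanges.

Arguments eCirc {O} A.
Arguments eBul {O} A.

Section FreeCornering.
Variable C : distributive_monoidal.

(* × and ⊞ are the exchanges "U × W" and "U + W"; ⊠ is the product of the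
   exchange monoid, as opposed to the tensor ⊗ of C. *)
Local Notation "A ° " := (@eCirc C A) (at level 1, format "A °").
Local Notation "A • " := (@eBul C A) (at level 1, format "A •").
Local Notation "U × W" := (@eProd C U W) (at level 40, left associativity).
Local Notation "U ⊞ W" := (@eSum C U W) (at level 50, left associativity).
Local Notation "U ⊠ W" := (@eTens C U W) (at level 40, left associativity).
Local Notation J := (@eUnit C).
Local Notation I := (@tunit C).

Inductive cterm : exch C -> C -> C -> exch C -> Type :=
| tHid U : cterm U I I U
| tVid A : cterm J A A J
| tHcomp U V W A B A' B' :
    cterm U A B V -> cterm V A' B' W -> cterm U (A ⊗ A') (B ⊗ B') W
| tVcomp U W U' W' A B D :
    cterm U A D W -> cterm U' D B W' -> cterm (U ⊠ U') A B (W ⊠ W')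
| tMor (A B : C) : hom A B -> cterm J A B J
| tGetL A : cterm A° I A J
| tPutR A : cterm J A I A°
| tGetR A : cterm J I A A•
| tPutL A : cterm A• A I J
| tPi0 U W : cterm (U × W) I I U
| tPi1 U W : cterm (U × W) I I W
| tPair V A B U W : cterm V A B U -> cterm V A B W -> cterm V A B (U × W)
| tIota0 U W : cterm U I I (U ⊞ W)
| tIota1 U W : cterm W I I (U ⊞ W)
| tCase U W A B V : cterm U A B V -> cterm W A B V -> cterm (U ⊞ W) A B V
| tCopair U A B D W : cterm U A D W -> cterm U B D W -> cterm U (A ⊕ B) D W.

(* The least congruence generated by the equations, the conditional rules
   [_uniq] being the uniqueness of the induced cells. It is heterogeneous, but
   related terms have equal boundaries in the edge monoids ([ceqv_boundary]). *)
Inductive ceqv : forall U A B W U' A' B' W',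
    cterm U A B W -> cterm U' A' B' W' -> Prop :=
| ce_refl U A B W (x : cterm U A B W) : ceqv x x
| ce_sym U A B W U' A' B' W' (x : cterm U A B W) (y : cterm U' A' B' W') :
    ceqv x y -> ceqv y x
| ce_trans U A B W U' A' B' W' U'' A'' B'' W'' (x : cterm U A B W)
    (y : cterm U' A' B' W') (z : cterm U'' A'' B'' W'') :
    ceqv x y -> ceqv y z -> ceqv x z
| ce_hcomp U V W A B A' B' U2 V2 W2 A2 B2 A2' B2'
    (x : cterm U A B V) (y : cterm V A' B' W)
    (x2 : cterm U2 A2 B2 V2) (y2 : cterm V2 A2' B2' W2) :
    ceqv x x2 -> ceqv y y2 -> ceqv (tHcomp x y) (tHcomp x2 y2)
| ce_vcomp U W U' W' A B D U2 W2 U2' W2' A2 B2 D2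
    (x : cterm U A D W) (y : cterm U' D B W')
    (x2 : cterm U2 A2 D2 W2) (y2 : cterm U2' D2 B2 W2') :
    ceqv x x2 -> ceqv y y2 -> ceqv (tVcomp x y) (tVcomp x2 y2)
| ce_pair V A B U W V2 A2 B2 U2 W2
    (x : cterm V A B U) (y : cterm V A B W)
    (x2 : cterm V2 A2 B2 U2) (y2 : cterm V2 A2 B2 W2) :
    ceqv x x2 -> ceqv y y2 -> ceqv (tPair x y) (tPair x2 y2)
| ce_case U W A B V U2 W2 A2 B2 V2
    (x : cterm U A B V) (y : cterm W A B V)
    (x2 : cterm U2 A2 B2 V2) (y2 : cterm W2 A2 B2 V2) :
    ceqv x x2 -> ceqv y y2 -> ceqv (tCase x y) (tCase x2 y2)
| ce_copair U A B D W U2 A2 B2 D2 W2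
    (x : cterm U A D W) (y : cterm U B D W)
    (x2 : cterm U2 A2 D2 W2) (y2 : cterm U2 B2 D2 W2) :
    ceqv x x2 -> ceqv y y2 -> ceqv (tCopair x y) (tCopair x2 y2)
| ce_hcompA U V W X A B A' B' A'' B''
    (x : cterm U A B V) (y : cterm V A' B' W) (z : cterm W A'' B'' X) :
    ceqv (tHcomp x (tHcomp y z)) (tHcomp (tHcomp x y) z)
| ce_hcomp1x U W A B (x : cterm U A B W) : ceqv (tHcomp (tHid U) x) x
| ce_hcompx1 U W A B (x : cterm U A B W) : ceqv (tHcomp x (tHid W)) x
| ce_vcompA U W U' W' U'' W'' A B D E
    (x : cterm U A B W) (y : cterm U' B D W') (z : cterm U'' D E W'') :
    ceqv (tVcomp x (tVcomp y z)) (tVcomp (tVcomp x y) z)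
| ce_vcomp1x U W A B (x : cterm U A B W) : ceqv (tVcomp (tVid A) x) x
| ce_vcompx1 U W A B (x : cterm U A B W) : ceqv (tVcomp x (tVid B)) x
| ce_hid_unit : ceqv (tHid J) (tVid I)
| ce_vid_op A B : ceqv (tVid (A ⊗ B)) (tHcomp (tVid A) (tVid B))
| ce_hid_op U W : ceqv (tHid (U ⊠ W)) (tVcomp (tHid U) (tHid W))
| ce_interchange U V W U' V' W' A B D A' B' D'
    (x : cterm U A D V) (y : cterm U' D B V')
    (z : cterm V A' D' W) (t : cterm V' D' B' W') :
    ceqv (tHcomp (tVcomp x y) (tVcomp z t)) (tVcomp (tHcomp x z) (tHcomp y t))
| ce_mor_comp (A B D : C) (f : hom A B) (g : hom B D) :
    ceqv (tMor (f ;; g)) (tVcomp (tMor f) (tMor g))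
| ce_mor_id (A : C) : ceqv (tMor (idm A)) (tVid A)
| ce_mor_tens (A B A' B' : C) (f : hom A B) (g : hom A' B') :
    ceqv (tMor (f ⊗m g)) (tHcomp (tMor f) (tMor g))
| ce_putR_getL A : ceqv (tHcomp (tPutR A) (tGetL A)) (tVid A)
| ce_getL_putR A : ceqv (tVcomp (tGetL A) (tPutR A)) (tHid A°)
| ce_getR_putL_h A : ceqv (tHcomp (tGetR A) (tPutL A)) (tVid A)
| ce_getR_putL_v A : ceqv (tVcomp (tGetR A) (tPutL A)) (tHid A•)
| ce_pair0 V A B U W (x : cterm V A B U) (y : cterm V A B W) :
    ceqv (tHcomp (tPair x y) (tPi0 U W)) x
| ce_pair1 V A B U W (x : cterm V A B U) (y : cterm V A B W) :
    ceqv (tHcomp (tPair x y) (tPi1 U W)) y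
| ce_pair_uniq V A B U W (x : cterm V A B U) (y : cterm V A B W)
    (h : cterm V A B (U × W)) :
    ceqv (tHcomp h (tPi0 U W)) x -> ceqv (tHcomp h (tPi1 U W)) y ->
    ceqv h (tPair x y)
| ce_case0 U W A B V (x : cterm U A B V) (y : cterm W A B V) :
    ceqv (tHcomp (tIota0 U W) (tCase x y)) x
| ce_case1 U W A B V (x : cterm U A B V) (y : cterm W A B V) :
    ceqv (tHcomp (tIota1 U W) (tCase x y)) y
| ce_case_uniq U W A B V (x : cterm U A B V) (y : cterm W A B V)
    (h : cterm (U ⊞ W) A B V) :
    ceqv (tHcomp (tIota0 U W) h) x -> ceqv (tHcomp (tIota1 U W) h) y ->
    ceqv h (tCase x y)
| ce_copair0 U A B D W (x : cterm U A D W) (y : cterm U B D W) :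
    ceqv (tVcomp (tMor (inj0 A B)) (tCopair x y)) x
| ce_copair1 U A B D W (x : cterm U A D W) (y : cterm U B D W) :
    ceqv (tVcomp (tMor (inj1 A B)) (tCopair x y)) y
| ce_copair_uniq U A B D W (x : cterm U A D W) (y : cterm U B D W)
    (h : cterm U (A ⊕ B) D W) :
    ceqv (tVcomp (tMor (inj0 A B)) h) x -> ceqv (tVcomp (tMor (inj1 A B)) h) y ->
    ceqv h (tCopair x y).

Lemma ceqv_boundary U A B W U' A' B' W'
    (x : cterm U A B W) (y : cterm U' A' B' W') :
  ceqv x y -> [/\ U = U', A = A', B = B' & W = W'].
Proof.
elim=> *; repeat match goal with H : [/\ _, _, _ & _] |- _ => case: H => * end;
  subst; split; rewrite // ?(eTensA, eTens1x, eTensx1, tensA, tens1x, tensx1) //.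
Qed.

Section CellQuotient.
Variables (U : exch C) (A B : C) (W : exch C).

HB.instance Definition _ := gen_eqMixin (cterm U A B W).
HB.instance Definition _ := gen_choiceMixin (cterm U A B W).

Definition ceqv_rel : rel (cterm U A B W) := fun x y => `[< ceqv x y >].

Lemma ceqv_rel_refl : reflexive ceqv_rel.
Proof. by move=> x; apply/asboolP; exact: ce_refl. Qed.

Lemma ceqv_rel_sym : symmetric ceqv_rel.
Proof. by move=> x y; apply/asboolP/asboolP; exact: ce_sym. Qed.

Lemma ceqv_rel_trans : transitive ceqv_rel.
Proof.
move=> y x z /asboolP xy /asboolP yz; apply/asboolP; exact: ce_trans xy yz.
Qed.

Canonical ceqv_equiv := EquivRel ceqv_rel ceqv_rel_refl ceqv_rel_sym ceqv_rel_trans.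

Definition fcell : Type := {eq_quot ceqv_rel}.

Definition fclass (x : cterm U A B W) : fcell := \pi_{eq_quot ceqv_rel} x.
Definition frepr (x : fcell) : cterm U A B W := @repr _ {eq_quot ceqv_rel} x.

Lemma freprK x : fclass (frepr x) = x.
Proof. exact: reprK. Qed.

Lemma fclassP x y : fclass x = fclass y <-> ceqv x y.
Proof.
split; first by move/eqmodP/asboolP.
by move=> xy; apply/eqmodP/asboolP.
Qed.

Lemma freprP x : ceqv (frepr (fclass x)) x.
Proof. by apply/fclassP; rewrite freprK. Qed.

End CellQuotient.

Lemma fclass_eq U A B W U' A' B' W'
    (x : cterm U A B W) (y : cterm U' A' B' W') :
  ceqv x y -> cell_eq (cell := fcell) (fclass x) (fclass y).
Proof.
move=> xy; have [eU eA eB eW] := ceqv_boundary xy.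
case: _ / eU y xy; case: _ / eA; case: _ / eB; case: _ / eW => y /fclassP ->.
exact: CellEq.
Qed.

Lemma fclass_eqr U A B W U' A' B' W'
    (x : cterm U A B W) (y : fcell U' A' B' W') :
  ceqv x (frepr y) -> cell_eq (cell := fcell) (fclass x) y.
Proof. by move/fclass_eq; rewrite freprK. Qed.

Definition fhid U : fcell U I I U := fclass (tHid U).
Definition fvid A : fcell J A A J := fclass (tVid A).
Definition fhcomp U V W A B A' B' (x : fcell U A B V) (y : fcell V A' B' W) :
    fcell U (A ⊗ A') (B ⊗ B') W :=
  fclass (tHcomp (frepr x) (frepr y)).
Definition fvcomp U W U' W' A B D (x : fcell U A D W) (y : fcell U' D B W') :
    fcell (U ⊠ U') A B (W ⊠ W') :=
  fclass (tVcomp (frepr x) (frepr y)).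

Lemma fhcompE U V W A B A' B' (x : cterm U A B V) (y : cterm V A' B' W) :
  fhcomp (fclass x) (fclass y) = fclass (tHcomp x y).
Proof. by apply/fclassP; apply: ce_hcomp; exact: freprP. Qed.

Lemma fvcompE U W U' W' A B D (x : cterm U A D W) (y : cterm U' D B W') :
  fvcomp (fclass x) (fclass y) = fclass (tVcomp x y).
Proof. by apply/fclassP; apply: ce_vcomp; exact: freprP. Qed.

Lemma fhcompA U V W X A B A' B' A'' B''
    (x : fcell U A B V) (y : fcell V A' B' W) (z : fcell W A'' B'' X) :
  cell_eq (cell := fcell) (fhcomp x (fhcomp y z)) (fhcomp (fhcomp x y) z).
Proof.
apply: fclass_eq; apply: ce_trans (ce_hcomp (ce_refl _) (freprP _)) _.
apply: ce_trans (ce_hcompA _ _ _) _.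
exact: ce_hcomp (ce_sym (freprP _)) (ce_refl _).
Qed.

Lemma fhcomp1x U W A B (x : fcell U A B W) :
  cell_eq (cell := fcell) (fhcomp (fhid U) x) x.
Proof.
apply: fclass_eqr; apply: ce_trans (ce_hcomp (freprP _) (ce_refl _)) _.
exact: ce_hcomp1x.
Qed.

Lemma fhcompx1 U W A B (x : fcell U A B W) :
  cell_eq (cell := fcell) (fhcomp x (fhid W)) x.
Proof.
apply: fclass_eqr; apply: ce_trans (ce_hcomp (ce_refl _) (freprP _)) _.
exact: ce_hcompx1.
Qed.

Lemma fvcompA U W U' W' U'' W'' A B D E
    (x : fcell U A B W) (y : fcell U' B D W') (z : fcell U'' D E W'') :
  cell_eq (cell := fcell) (fvcomp x (fvcomp y z)) (fvcomp (fvcomp x y) z).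
Proof.
apply: fclass_eq; apply: ce_trans (ce_vcomp (ce_refl _) (freprP _)) _.
apply: ce_trans (ce_vcompA _ _ _) _.
exact: ce_vcomp (ce_sym (freprP _)) (ce_refl _).
Qed.

Lemma fvcomp1x U W A B (x : fcell U A B W) :
  cell_eq (cell := fcell) (fvcomp (fvid A) x) x.
Proof.
apply: fclass_eqr; apply: ce_trans (ce_vcomp (freprP _) (ce_refl _)) _.
exact: ce_vcomp1x.
Qed.

Lemma fvcompx1 U W A B (x : fcell U A B W) :
  cell_eq (cell := fcell) (fvcomp x (fvid B)) x.
Proof.
apply: fclass_eqr; apply: ce_trans (ce_vcomp (ce_refl _) (freprP _)) _.
exact: ce_vcompx1.
Qed.

Lemma fhid_unit : cell_eq (cell := fcell) (fhid J) (fvid I).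
Proof. exact: fclass_eq ce_hid_unit. Qed.

Lemma fvid_op A B :
  cell_eq (cell := fcell) (fvid (A ⊗ B)) (fhcomp (fvid A) (fvid B)).
Proof. by rewrite fhcompE; exact: fclass_eq (ce_vid_op _ _). Qed.

Lemma fhid_op U W :
  cell_eq (cell := fcell) (fhid (U ⊠ W)) (fvcomp (fhid U) (fhid W)).
Proof. by rewrite fvcompE; exact: fclass_eq (ce_hid_op _ _). Qed.

Lemma finterchange U V W U' V' W' A B D A' B' D'
    (x : fcell U A D V) (y : fcell U' D B V')
    (z : fcell V A' D' W) (t : fcell V' D' B' W') :
  fhcomp (fvcomp x y) (fvcomp z t) = fvcomp (fhcomp x z) (fhcomp y t).
Proof.
apply/fclassP; apply: ce_trans (ce_hcomp (freprP _) (freprP _)) _.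
apply: ce_trans (ce_interchange _ _ _ _) _.
by apply: ce_vcomp; apply: ce_sym; exact: freprP.
Qed.

Definition free_cornering : double_category :=
  @DoubleCategory (obj_monoid C) (exchanges C) fcell fhid fvid fhcomp fvcomp
    fhcompA fhcomp1x fhcompx1 fvcompA fvcomp1x fvcompx1
    fhid_unit fvid_op fhid_op finterchange.

Definition fPi0 (U W : horizontal_cells free_cornering) :
  @hom (horizontal_cells free_cornering) (U × W) U := fclass (tPi0 U W).
Definition fPi1 (U W : horizontal_cells free_cornering) :
  @hom (horizontal_cells free_cornering) (U × W) W := fclass (tPi1 U W).
Definition fIota0 (U W : horizontal_cells free_cornering) :
  @hom (horizontal_cells free_cornering) U (U ⊞ W) := fclass (tIota0 U W).
Definition fIota1 (U W : horizontal_cells free_cornering) :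
  @hom (horizontal_cells free_cornering) W (U ⊞ W) := fclass (tIota1 U W).

End FreeCornering.

Arguments fPi0 {C} U W.
Arguments fPi1 {C} U W.
Arguments fIota0 {C} U W.
Arguments fIota1 {C} U W.

(* Main.v *)
Require Import Defs.
From mathcomp Require Import ssreflect.

(** Both universal properties are the generating rules for [tPair] and [tCase], taken at top and
    bottom boundary I: the computation rules give existence, the [_uniq] rules uniqueness.
    [hc_comp_ceqv] carries equations between composites of horizontal cells over to [ceqv] on
    terms. *)

(** A converse to [fclass_eq], leading from cells back to terms. *)
Lemma frepr_ceqv (C : distributive_monoidal) (U U' W W' : exch C)
    (A B A' B' : C) (x : fcell U A B W) (y : fcell U' A' B' W') :
  x ≡ y -> ceqv (frepr x) (frepr y).
Proof. by case; exact: ce_refl. Qed.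

(* [hc_comp] and [hcomp] differ by the transport along I ⊗ I = I, which the
   heterogeneous relation [ceqv] absorbs. *)
Lemma hc_comp_ceqv (C : distributive_monoidal) (U V W : exch C)
    (x : cterm U tunit tunit V) (y : cterm V tunit tunit W)
    (z : cterm U tunit tunit W) :
  @hc_comp (free_cornering C) U V W (fclass x) (fclass y) = fclass z <->
  ceqv (tHcomp x y) z.
Proof.
have xyE := @hc_compE (free_cornering C) U V W (fclass x) (fclass y).
rewrite /= fhcompE in xyE; split=> [e | /fclass_eq e].
  rewrite e in xyE; have /frepr_ceqv xyz := cell_eq_sym xyE.
  exact: ce_trans (ce_sym (freprP (tHcomp x y))) (ce_trans xyz (freprP z)).
exact: cell_eqE (cell_eq_trans xyE e).
Qed.

Theorem lemma9 (A : distributive_monoidal) :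
  (forall U W : horizontal_cells (free_cornering A),
     is_product U W (eProd U W) (fPi0 U W) (fPi1 U W)) /\
  (forall U W : horizontal_cells (free_cornering A),
     is_coproduct U W (eSum U W) (fIota0 U W) (fIota1 U W)).
Proof.
(* Cells become classes of terms, the form [hc_comp_ceqv] expects. *)
split=> U W Z f g; rewrite -(freprK f) -(freprK g).
- exists (fclass (tPair (frepr f) (frepr g))); split.
    by split; apply/hc_comp_ceqv; [exact: ce_pair0 | exact: ce_pair1].
  move=> h; rewrite -(freprK h) => -[/hc_comp_ceqv h0 /hc_comp_ceqv h1].
  (* [exists!] puts the witness on the left, [ce_pair_uniq] on the right. *)
  by apply/fclassP/ce_sym/ce_pair_uniq.
- exists (fclass (tCase (frepr f) (frepr g))); split.
    by split; apply/hc_comp_ceqv; [exact: ce_case0 | exact: ce_case1].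
  move=> h; rewrite -(freprK h) => -[/hc_comp_ceqv h0 /hc_comp_ceqv h1].
  by apply/fclassP/ce_sym/ce_case_uniq.
Qed.
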